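(* Let $\varepsilon>0$, let $\xi^1,\xi^2\in\{1,-1\}^N$ with $\xi^1\neq\pm\xi^2$, let $C_{ij}=\xi^1_i\xi^1_j+\xi^2_i\xi^2_j$, and let $k\in\{1,2\}$. Let $\tilde\varphi(t)=(\tilde\varphi_1(t),\dots,\tilde\varphi_N(t))$, $t\ge0$, be a (real-valued) solution of $$\dot{\tilde\varphi}_i=\frac1N\sum_{j=1}^N\big(C_{ij}\xi^k_i\xi^k_j+2\varepsilon\cos(\tilde\varphi_j-\tilde\varphi_i)\big)\sin(\tilde\varphi_j-\tilde\varphi_i),\qquad i=1,\dots,N,$$ and let $\mathcal D(\tilde\varphi(t))=\max_{1\le i,j\le N}(\tilde\varphi_i(t)-\tilde\varphi_j(t))$. If $\mathcal D(\tilde\varphi(0))<\frac{\pi}{2}$, then: (1) $\sup_{t\in[0,\infty)}\mathcal D(\tilde\varphi(t))<\frac{\pi}{2}$; (2) there exists $\lambda>0$ such that $\mathcal D(\tilde\varphi(t))\le\mathcal D(\tilde\varphi(0))e^{-\lambda t}$ for all $t\in[0,\infty)$.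
   Context: The system for $\tilde\varphi$ arises from $\dot\varphi_i=\frac1N\sum_j C_{ij}\sin(\varphi_j-\varphi_i)+\frac{\varepsilon}{N}\sum_j\sin2(\varphi_j-\varphi_i)$ by setting $\tilde\varphi_i=\varphi_i-\varphi_i^*(\xi^k)$, where $\varphi^*(\xi^k)$ is the equilibrium in which phases $i,j$ are equal mod $2\pi$ when $\xi^k_i=\xi^k_j$ and differ by $\pi$ mod $2\pi$ otherwise. *)

(* Defs.v *)
From HB Require Import structures.
From mathcomp Require Import all_boot all_order all_algebra.
From mathcomp Require Import all_classical all_reals all_analysis.

Set Implicit Arguments.
Unset Strict Implicit.
Unset Printing Implicit Defensive.

Import Order.TTheory GRing.Theory Num.Theory.
Import numFieldNormedType.Exports.

Local Open Scope classical_set_scope.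
Local Open Scope ring_scope.

(* The two patterns xi^1, xi^2 are [xi 0] and [xi 1]. *)
Definition coupling (R : realType) (N : nat) (xi : 'I_2 -> 'rV[R]_N)
    (i j : 'I_N) : R :=
  xi 0 0 i * xi 0 0 j + xi 1 0 i * xi 1 0 j.

Definition shifted_field (R : realType) (N : nat) (eps : R)
    (xi : 'I_2 -> 'rV[R]_N) (k : 'I_2) (x : 'rV[R]_N) (i : 'I_N) : R :=
  N%:R^-1 * \sum_(j < N)
    (coupling xi i j * (xi k 0 i * xi k 0 j) +
     2 * eps * cos (x 0 j - x 0 i)) * sin (x 0 j - x 0 i).

(* Only the values of [phi] on [0, +oo[ matter: at t = 0 the derivative is
   the right derivative. *)
Definition is_solution (R : realType) (N : nat) (eps : R)
    (xi : 'I_2 -> 'rV[R]_N) (k : 'I_2) (phi : R -> 'rV[R]_N) : Prop :=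
  forall i : 'I_N,
    (forall t : R, 0 < t ->
       is_derive t 1 (fun s => phi s 0 i) (shifted_field eps xi k (phi t) i)) /\
    h^-1 * (phi h 0 i - phi 0 0 i) @[h --> 0^'+]
      --> shifted_field eps xi k (phi 0) i.

(* For N > 0 the default value 0 does not affect the maximum, since the
   diagonal terms i = j are 0. *)
Definition phase_diameter (R : realType) (N : nat) (x : 'rV[R]_N) : R :=
  \big[Num.max/0]_(i < N) \big[Num.max/0]_(j < N) (x 0 i - x 0 j).

(* Main.v *)
(* Multiplying C_ij by xi^k_i xi^k_j gives 1 + eta_i eta_j with
   eta = xi^1 xi^2, which is nonnegative, so while the diameter is at most
   d < pi/2 every interaction is attractive with weight at least 2 eps cos d.
   Since sin y >= y cos d on [0, d], the gap between a largest and a smallest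
   phase decreases at rate at least 2 eps cos(d)^2.  A first-crossing argument
   for all pairs of phases against the barrier b exp(- eps cos(d)^2 t), for
   D(phi(0)) < b <= d, keeps the diameter below the barrier (half the
   contraction rate makes the crossing inequality strict); then b is sent to
   D(phi(0)) with d, hence the rate, fixed. *)

Require Import Defs.
From HB Require Import structures.
From mathcomp Require Import all_boot all_order all_algebra.
From mathcomp Require Import all_classical all_reals all_analysis.
From mathcomp Require Import lra ring.

Set Implicit Arguments.
Unset Strict Implicit.
Unset Printing Implicit Defensive.

Import Order.TTheory GRing.Theory Num.Theory.
Import numFieldNormedType.Exports.
Local Open Scope classical_set_scope.
Local Open Scope ring_scope.

(** * Barrier argument for finitely many real functions *)

(** The difference quotient is positive for small increments; when the increment is negative, so is
    its numerator. *)
Lemma is_derive_gt0_left (R : realType) (f : R -> R) (t d : R) :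
  is_derive t 1 f d -> 0 < d -> \forall s \near t^'-, f s < f t.
Proof.
move=> fd d0.
have : h^-1 *: (f (h *: 1 + t) - f t) @[h --> 0^'] --> d.
  by case: fd => fd <-; exact: fd.
move=> /cvgr_gt/(_ _ d0) /nbhs_ballP[e /= e0 he].
near=> s.
have st : s < t by near: s; exact: nbhs_left_lt.
have /he : ball 0 e (s - t).
  rewrite /ball /= sub0r normrN ltr0_norm ?subr_lt0// opprB ltrBlDr -ltrBlDl.
  by near: s; apply: nbhs_left_gt; rewrite ltrBlDr ltrDl.
rewrite /= lt_eqF ?subr_lt0// => /(_ isT).
rewrite [_ *: 1]mulr1 subrK [_ *: _]/(_ * _) nmulr_rgt0 ?subr_lt0//.
by rewrite invr_lt0 subr_lt0.
Unshelve. all: by end_near. Qed.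

(* [barrier] excludes a first zero t: there f i would reach 0 from above
   with a positive derivative. *)
Lemma positivity_barrier (R : realType) (I : finType) (f df : I -> R -> R) :
  (forall i, 0 < f i 0) ->
  (forall i, f i s @[s --> 0^'+] --> f i 0) ->
  (forall i (t : R), 0 < t -> is_derive t 1 (f i) (df i t)) ->
  (forall i (t : R), 0 < t -> (forall j, 0 <= f j t) -> f i t = 0 -> 0 < df i t) ->
  forall i t, 0 <= t -> 0 < f i t.
Proof.
move=> f0 f0r fd barrier.
pose A : set R := [set t | 0 <= t /\ exists i, f i t <= 0].
suff A0 : A = set0.
  move=> i t t0; rewrite ltNge; apply/negP => fit.
  by have : A t; [split=> //; exists i | rewrite A0].
apply/eqP; apply: contrapT => /negP/set0P An0.
have Alb : lbound A 0 by move=> t [].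
have Ainf : has_inf A by split=> //; exists 0.
set T := inf A.
have T0 : 0 <= T by exact: lb_le_inf.
have before s : 0 <= s -> s < T -> forall i, 0 < f i s.
  move=> s0 sT i; rewrite ltNge; apply/negP => fis.
  have : T <= s by apply: ge_inf; [exists 0|split=> //; exists i].
  by rewrite leNgt sT.
(* At [T = 0] this is the hypothesis; for [T > 0] it follows from derivability. *)
have fr i : f i s @[s --> T^'+] --> f i T.
  have [->//|Tn0] := eqVneq T 0.
  have Tgt0 : 0 < T by rewrite lt_neqAle eq_sym Tn0.
  apply: cvg_at_right_filter.
  have [+ _] := fd i _ Tgt0.
  by move/derivable1_diffP/differentiable_continuous.
(* The infimum is attained: otherwise, [I] being finite, all [f i] stay positive on a common right
   neighbourhood of [T], which contains a point of [A]. *)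
have [i fiT] : exists i, f i T <= 0.
  apply: contrapT => nex.
  have fT i : 0 < f i T.
    by rewrite ltNge; apply/negP => fiT; apply: nex; exists i.
  have : \forall s \near T^'+, forall i, 0 < f i s.
    by apply: filter_forall => i; exact: (cvgr_gt _ (fr i)).
  move=> /nbhs_ballP[e /= e0 he].
  have [s [s0 [i fis]] sTe] := inf_adherent e0 Ainf.
  have Ts : T <= s by apply: ge_inf; [exists 0|split=> //; exists i].
  have Tns : T != s by apply: contraTN fis => /eqP <-; rewrite -ltNge.
  have Tlts : T < s by rewrite lt_neqAle Tns.
  have := he s; rewrite /ball /= ltr0_norm ?subr_lt0//.
  by rewrite opprB ltrBlDl => /(_ sTe Tlts i); rewrite ltNge fis.
have Tgt0 : 0 < T.
  rewrite lt_neqAle T0 andbT; apply: contraTneq fiT => <-.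
  by rewrite -ltNge.
have fleft j : 0 <= f j T.
  have : f j s @[s --> T^'-] --> f j T.
    apply: cvg_at_left_filter; have [+ _] := fd j _ Tgt0.
    by move/derivable1_diffP/differentiable_continuous.
  move/cvgr_to_ge; apply.
  near=> s; apply/ltW/before; last by near: s; exact: nbhs_left_lt.
  by near: s; exact: nbhs_left_ge.
have fiT0 : f i T = 0 by apply/eqP; rewrite eq_le fiT fleft.
have dpos := barrier i T Tgt0 fleft fiT0.
have near_lt := is_derive_gt0_left (fd i T Tgt0) dpos.
(* Just before [T], [f i] would already be below [f i T = 0], against [before]. *)
have [s [[s0 sT] fis]] : exists s, (0 <= s /\ s < T) /\ f i s < f i T.
  near T^'- => s; exists s; split; last by near: s.
  by split; near: s; [exact: nbhs_left_ge | exact: nbhs_left_lt].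
by have := lt_trans (before s s0 sT i) fis; rewrite fiT0 ltxx.
Unshelve. all: by end_near. Qed.

(** * Bounds on sine and cosine, and right continuity at 0 *)

Lemma cos_le_pi (R : realType) (x y : R) :
  0 <= x -> x <= y -> y <= pi -> cos y <= cos x.
Proof.
move=> x0 xy ypi.
have cos_decr : {in `[0, pi] &, {homo (@cos R) : x y /~ x < y}}.
  by move=> u v hu hv; rewrite ltr_cos.
rewrite (le_nmono_in cos_decr)// in_itv/= ?x0 ?ypi ?(le_trans xy)//.
by rewrite (le_trans x0).
Qed.

(** By the mean value theorem [sin x = cos c * x] with [c] between 0 and [x], and
    [cos c >= cos d]. *)
Lemma sin_ge_mul_cos (R : realType) (x d : R) :
  0 <= x -> x <= d -> d < pi / 2 -> x * cos d <= sin x.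
Proof.
move=> x0 xd dpi.
have d0 : 0 <= d := le_trans x0 xd.
have pi2 : pi / 2 <= pi :> R by have := pi_ge0 R; lra.
have cx : {within `[0, x], continuous (@sin R)}.
  by apply: continuous_subspaceT => y; exact: continuous_sin.
have [c] := MVT_segment x0 (fun y _ => is_derive_sin y) cx.
rewrite in_itv/= sin0 !subr0 => /andP[c0 cle] ->.
rewrite mulrC ler_wpM2r// cos_le_pi// ?c0 ?(le_trans cle)//.
by lra.
Qed.

(** Turns the one-sided derivative of a solution at 0 into the right continuity that
    [positivity_barrier] asks for. *)
Lemma cvg_right0_of_quotient (R : realType) (f : R -> R) (l : R) :
  h^-1 * (f h - f 0) @[h --> 0^'+] --> l -> f s @[s --> 0^'+] --> f 0.
Proof.
move=> fl.
have h0 : h @[h --> (0 : R)^'+] --> (0 : R) by apply: cvg_at_right_filter; exact: cvg_id.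
have : f 0 + h * (h^-1 * (f h - f 0)) @[h --> 0^'+] --> f 0 + 0 * l.
  by apply: cvgD; [exact: cvg_cst | exact: cvgM].
rewrite mul0r addr0; apply: cvg_trans; apply: near_eq_cvg.
near=> h; have hn0 : h != 0 by rewrite gt_eqF//; near: h; exact: nbhs_right_gt.
by rewrite mulrA mulfV// mul1r addrC subrK.
Unshelve. all: by end_near. Qed.

(** * Contraction estimate for the vector field *)

Lemma coupling_pattern_ge0 (R : realType) (N : nat) (xi : 'I_2 -> 'rV[R]_N)
    (k : 'I_2) (i j : 'I_N) :
  (forall m i, xi m 0 i = 1 \/ xi m 0 i = -1) ->
  0 <= coupling xi i j * (xi k 0 i * xi k 0 j).
Proof.
move=> hxi; rewrite /coupling.
have [->|->] : k = 0 \/ k = 1.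
- by case: k => -[|[|//]] kP; [left|right]; exact/val_inj.
- by case: (hxi 0 i) => ->; case: (hxi 0 j) => ->;
    case: (hxi 1 i) => ->; case: (hxi 1 j) => ->; lra.
- by case: (hxi 0 i) => ->; case: (hxi 0 j) => ->;
    case: (hxi 1 i) => ->; case: (hxi 1 j) => ->; lra.
Qed.

(** One factor [cos d] bounds the weight [cos y], the other comes from [sin y >= y * cos d]. *)
Lemma interaction_ge (R : realType) (a eps d y : R) :
  0 <= a -> 0 < eps -> 0 <= y -> y <= d -> d < pi / 2 ->
  2 * eps * cos d ^+ 2 * y <= (a + 2 * eps * cos y) * sin y.
Proof.
move=> a0 eps0 y0 yd dpi.
have pi2 : pi / 2 <= pi :> R by have := pi_ge0 R; lra.
have cosd0 : 0 < cos d by apply: cos_gt0_pihalf; apply/andP; lra.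
have cosdy : cos d <= cos y by apply: cos_le_pi => //; lra.
have siny := sin_ge_mul_cos y0 yd dpi.
rewrite (_ : _ * y = (2 * eps * cos d) * (y * cos d)); last by ring.
apply: ler_pM => //; [by rewrite !mulr_ge0// ltW|by rewrite mulr_ge0// ltW|].
by rewrite -[leLHS]add0r lerD// ler_pM2l// mulr_gt0.
Qed.

(** This reflection reduces the estimate at a largest phase to the one at a smallest phase. *)
Lemma shifted_fieldN (R : realType) (N : nat) (eps : R)
    (xi : 'I_2 -> 'rV[R]_N) (k : 'I_2) (x : 'rV[R]_N) (i : 'I_N) :
  shifted_field eps xi k (- x) i = - shifted_field eps xi k x i.
Proof.
rewrite /shifted_field -mulrN -sumrN; congr (_ * _); apply: eq_bigr => j _.
by rewrite !mxE -opprD cosN sinN mulrN.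
Qed.

Lemma shifted_field_min_ge (R : realType) (N : nat) (eps d : R)
    (xi : 'I_2 -> 'rV[R]_N) (k : 'I_2) (x : 'rV[R]_N) (i : 'I_N) :
  0 < eps -> (forall m i, xi m 0 i = 1 \/ xi m 0 i = -1) -> d < pi / 2 ->
  (forall j, 0 <= x 0 j - x 0 i <= d) ->
  N%:R^-1 * \sum_(j < N) 2 * eps * cos d ^+ 2 * (x 0 j - x 0 i)
    <= shifted_field eps xi k x i.
Proof.
move=> eps0 hxi dpi hx; rewrite ler_wpM2l ?invr_ge0//.
apply: ler_sum => j _; have /andP[x0 xd] := hx j.
by apply: interaction_ge => //; exact: coupling_pattern_ge0.
Qed.

Lemma shifted_field_gap_le (R : realType) (N : nat) (eps d : R)
    (xi : 'I_2 -> 'rV[R]_N) (k : 'I_2) (x : 'rV[R]_N) (i j : 'I_N) :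
  0 < eps -> (forall m i, xi m 0 i = 1 \/ xi m 0 i = -1) -> d < pi / 2 ->
  (forall l, x 0 j <= x 0 l <= x 0 i) -> x 0 i - x 0 j <= d ->
  shifted_field eps xi k x i - shifted_field eps xi k x j
    <= - (2 * eps * cos d ^+ 2 * (x 0 i - x 0 j)).
Proof.
move=> eps0 hxi dpi hx xd.
have N0 : N%:R != 0 :> R by rewrite pnatr_eq0 -lt0n (leq_trans _ (ltn_ord i)).
have dj l : 0 <= x 0 l - x 0 j <= d by have := hx l; lra.
have di l : 0 <= (- x) 0 l - (- x) 0 i <= d.
  by have := hx l; rewrite !mxE; lra.
have hj := shifted_field_min_ge k eps0 hxi dpi dj.
have hi := shifted_field_min_ge k eps0 hxi dpi di.
rewrite shifted_fieldN in hi.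
(* For each [l], the distances from [x_j] up to [x_l] and from [x_l] up to [x_i] add up to the whole
   gap, so averaging over [l] returns the gap. *)
have -> : 2 * eps * cos d ^+ 2 * (x 0 i - x 0 j) =
    N%:R^-1 * \sum_(l < N) 2 * eps * cos d ^+ 2 * (x 0 l - x 0 j) +
    N%:R^-1 * \sum_(l < N) 2 * eps * cos d ^+ 2 * ((- x) 0 l - (- x) 0 i).
  rewrite -mulrDr -big_split/=.
  rewrite (eq_bigr (fun=> 2 * eps * cos d ^+ 2 * (x 0 i - x 0 j))).
    by rewrite sumr_const card_ord -[X in _^-1 * X]mulr_natl mulKf.
  by move=> l _; rewrite !mxE; ring.
by rewrite opprD addrC lerD// ?lerN2// lerNr.
Qed.

(** * The diameter and its exponential decay *)

Lemma phase_diameter_ge0 (R : realType) (N : nat) (x : 'rV[R]_N) :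
  0 <= phase_diameter x.
Proof. exact: bigmax_ge_id. Qed.

Lemma phase_diameter_ge (R : realType) (N : nat) (x : 'rV[R]_N) (i j : 'I_N) :
  x 0 i - x 0 j <= phase_diameter x.
Proof.
apply: (le_trans (le_bigmax _ (fun j => x 0 i - x 0 j) j)).
exact: (le_bigmax _ (fun i => \big[Num.max/0]_j (x 0 i - x 0 j)) i).
Qed.

Lemma phase_diameter_le (R : realType) (N : nat) (x : 'rV[R]_N) (b : R) :
  0 <= b -> (forall i j, x 0 i - x 0 j <= b) -> phase_diameter x <= b.
Proof. by move=> b0 xb; do 2!apply: bigmax_le => // ? _. Qed.

Lemma expRN_le1 (R : realType) (x y : R) :
  0 <= x -> 0 <= y -> expR (- x * y) <= 1.
Proof. by move=> x0 y0; rewrite -expR0 ler_expR mulNr oppr_le0 mulr_ge0. Qed.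

Lemma phase_diameter_lt_exp (R : realType) (N : nat) (eps d b : R)
    (xi : 'I_2 -> 'rV[R]_N) (k : 'I_2) (phi : R -> 'rV[R]_N) :
  0 < eps -> (forall m i, xi m 0 i = 1 \/ xi m 0 i = -1) ->
  is_solution eps xi k phi -> phase_diameter (phi 0) < b -> b <= d ->
  d < pi / 2 ->
  forall i j (t : R), 0 <= t ->
    phi t 0 i - phi t 0 j < b * expR (- (eps * cos d ^+ 2) * t).
Proof.
move=> eps0 hxi sol phib bd dpi i j t t0.
have b0 : 0 < b := le_lt_trans (phase_diameter_ge0 _) phib.
have cosd0 : 0 < cos d by apply: cos_gt0_pihalf; apply/andP; lra.
set mu := eps * cos d ^+ 2.
have mu0 : 0 < mu by rewrite mulr_gt0// exprn_gt0.
pose B (s : R) : R := b * expR (- mu * s).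
have dB (s : R) : is_derive s 1 B (- mu * B s).
  have dlin : is_derive s 1 (fun u : R => - mu * u) (- mu).
    by apply: (is_derive_eq (is_deriveZ _ _)); rewrite [_ *: _]mulr1.
  have dexp := is_derive1_comp (is_derive_expR (- mu * s)) dlin.
  apply: (is_derive_eq (is_deriveZ b dexp)).
  have e : b * (expR (- mu * s) * - mu) = - mu * B s by rewrite /B; ring.
  exact: e.
pose f (p : 'I_N * 'I_N) (s : R) : R := B s - (phi s 0 p.1 - phi s 0 p.2).
pose df (p : 'I_N * 'I_N) (s : R) : R := - mu * B s -
  (shifted_field eps xi k (phi s) p.1 - shifted_field eps xi k (phi s) p.2).
(* Gaps below the barrier thus stay in the range where the contraction estimate applies. *)
have Bd s : 0 <= s -> B s <= d.
  move=> s0; apply: le_trans bd; rewrite -[leRHS]mulr1 ler_pM2l//.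
  by rewrite expRN_le1// ltW.
suff fpos : forall p (s : R), 0 <= s -> 0 < f p s.
  by have := fpos (i, j) t t0; rewrite /f subr_gt0.
apply: (@positivity_barrier R _ f df).
- move=> p; rewrite /f /B mulr0 expR0 mulr1 subr_gt0.
  exact: le_lt_trans (phase_diameter_ge _ _ _) phib.
- move=> p; apply: cvgB; last first.
    by apply: cvgB; apply: cvg_right0_of_quotient (sol _).2.
  apply: cvg_at_right_filter; have [+ _] := dB 0.
  by move/derivable1_diffP/differentiable_continuous.
- move=> p s s0; have [+ _] := sol p.1; have [+ _] := sol p.2.
  move=> /(_ s s0) d2 /(_ s s0) d1.
  by apply: is_deriveB.
- move=> p s s0 fge fp.
  have gap l m : phi s 0 l - phi s 0 m <= B s.
    by have := fge (l, m); rewrite /f subr_ge0.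
  have gapp : phi s 0 p.1 - phi s 0 p.2 = B s.
    by move: fp; rewrite /f => /eqP; rewrite subr_eq0 => /eqP.
  (* A pair touching the barrier realizes the diameter, so it consists of a largest and a smallest
     phase. *)
  have bet l : phi s 0 p.2 <= phi s 0 l <= phi s 0 p.1.
    by have := gap l p.2; have := gap p.1 l; rewrite -gapp; lra.
  have := @shifted_field_gap_le _ _ eps d xi k (phi s) p.1 p.2 eps0 hxi dpi bet.
  rewrite gapp -[2 * eps * _]mulrA -/mu => /(_ (Bd _ (ltW s0))); rewrite /df.
  (* The gap shrinks at rate at least [2 * mu], the barrier at rate [mu]; the surplus [mu * B s]
     gives strictness. *)
  have : 0 < mu * B s by rewrite !mulr_gt0// expR_gt0.
  by lra.
Qed.

Unset Implicit Arguments.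

Theorem theorem2p2 (R : realType) (N : nat) (eps : R) (heps : 0 < eps)
    (xi : 'I_2 -> 'rV[R]_N)
    (hxi : forall (m : 'I_2) (i : 'I_N), xi m 0 i = 1 \/ xi m 0 i = -1)
    (hneq : xi 0 <> xi 1) (hneqN : xi 0 <> - xi 1)
    (k : 'I_2) (phi : R -> 'rV[R]_N) (hphi : is_solution eps xi k phi)
    (hD0 : phase_diameter (phi 0) < pi / 2) :
  (ereal_sup [set (phase_diameter (phi t))%:E | t in `[0%R, +oo[]
     < (pi / 2)%:E)%E /\
  exists lambda : R, 0 < lambda /\
    forall t : R, 0 <= t ->
      phase_diameter (phi t) <= phase_diameter (phi 0) * expR (- lambda * t).
Proof.
set D0 := phase_diameter (phi 0) in hD0 *.
have D00 : 0 <= D0 by exact: phase_diameter_ge0.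
pose d := (D0 + pi / 2) / 2.
have [D0d dpi] : D0 < d /\ d < pi / 2 by rewrite /d; split; lra.
pose lambda := eps * cos d ^+ 2.
have lambda0 : 0 < lambda.
  by rewrite mulr_gt0// exprn_gt0// cos_gt0_pihalf//; apply/andP; lra.
have decay t : 0 <= t -> phase_diameter (phi t) <= D0 * expR (- lambda * t).
  move=> t0; apply: phase_diameter_le; first by rewrite mulr_ge0// expR_ge0.
  move=> i j; apply/ler_addgt0Pr => e e0.
  (* Capping at [d] keeps [lambda] independent of [e]. *)
  pose b := Num.min (D0 + e) d.
  have D0b : D0 < b by rewrite lt_min ltrDl e0.
  have bd : b <= d by rewrite ge_min lexx orbT.
  have /ltW := phase_diameter_lt_exp heps hxi hphi D0b bd dpi i j t0.
  move=> /le_trans; apply; rewrite -/lambda.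
  have bD0e : b <= D0 + e by rewrite ge_min lexx.
  apply: (le_trans (ler_wpM2r (expR_ge0 _) bD0e)).
  by rewrite mulrDl lerD2l ler_piMr ?expRN_le1// ltW.
split; last by exists lambda.
(* By the decay, every diameter is at most [D0], which leaves a strict margin below [pi / 2] for the
   supremum. *)
apply: (@le_lt_trans _ _ D0%:E); last by rewrite lte_fin.
apply: ge_ereal_sup => ? [t /=]; rewrite in_itv/= andbT => t0 <-.
rewrite lee_fin (le_trans (decay t t0))// ler_piMr//.
by rewrite expRN_le1// ltW.
Qed.
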